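(* Let $X$ be a compact metric space and let $F:X\to 2^X$ be upper semi-continuous. Let $\overrightarrow{\mathrm{Orb}}(X,F)$ be the space of forward orbits of $F$, with the metric $\rho$, and let $\sigma:\overrightarrow{\mathrm{Orb}}(X,F)\to\overrightarrow{\mathrm{Orb}}(X,F)$ be the shift map defined by $\sigma(x_0,x_1,x_2,\ldots)=(x_1,x_2,x_3,\ldots)$. Then $h(\sigma)=h(F)$.
   Context: $\mathbb{N}=\{1,2,\ldots\}$. For a compact metric space $X$ with metric $d$, $2^X$ is the set of non-empty compact subsets of $X$. $F:X\to 2^X$ is upper semi-continuous if for every $x\in X$ and every open $V\subseteq X$ containing $F(x)$ there is an open $U\ni x$ with $F(t)\subseteq V$ for all $t\in U$. Orbits: for $n\in\mathbb{N}$, $\mathrm{Orb}_n(X,F)$ is the set of $n$-orbits, i.e. finite sequences $(x_0,\ldots,x_{n-1})$ in $X$ with $x_{i+1}\in F(x_i)$ for $0\le i\le n-2$, with the metric $D(\mathbf{x},\mathbf{y})=\max_{0\le i\le n-1}d(x_i,y_i)$. $\overrightarrow{\mathrm{Orb}}(X,F)$ is the set of forward orbits, i.e. sequences $(x_0,x_1,\ldots)$ in $X$ with $x_{i+1}\in F(x_i)$ for all $i\ge 0$, with the metric $\rho(\mathbf{x},\mathbf{y})=\sup_{i\ge 0}\frac{d(x_i,y_i)}{i+1}$ (inducing the subspace topology of the product topology). Entropy of a set-valued function: a subset $S$ of a metric space is $\epsilon$-separated if any two distinct points of $S$ are at distance $\ge\epsilon$. For $n\in\mathbb{N}$, $\epsilon>0$,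 $s_{n,\epsilon}(F)$ is the largest cardinality of an $\epsilon$-separated subset of $(\mathrm{Orb}_n(X,F),D)$. The topological entropy of $F$ is $h(F)=\lim_{\epsilon\to0}\limsup_{n\to\infty}\frac1n\log s_{n,\epsilon}(F)\in[0,\infty]$. Entropy of a continuous single-valued map $f:Y\to Y$ on a compact metric space $(Y,d_Y)$: a set $S\subseteq Y$ is $(n,\epsilon)$-separated if $\max_{0\le i\le n-1}d_Y(f^i(x),f^i(y))\ge\epsilon$ for all distinct $x,y\in S$; $s_{n,\epsilon}(f)$ is the largest cardinality of such a set, and $h(f)=\lim_{\epsilon\to0}\limsup_{n\to\infty}\frac1n\log s_{n,\epsilon}(f)$. *)

(* Defs.v *)
From HB Require Import structures.
From mathcomp Require Import all_boot all_order all_algebra.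
From mathcomp Require Import all_classical all_reals all_analysis.

Set Implicit Arguments.
Unset Strict Implicit.
Unset Printing Implicit Defensive.

Import Order.TTheory GRing.Theory Num.Theory.
Import numFieldNormedType.Exports.

Local Open Scope classical_set_scope.
Local Open Scope ring_scope.

(* The family 2^X, as a set of subsets of X. *)
Definition hyperspace (X : topologicalType) : set (set X) :=
  [set A | A !=set0 /\ compact A].

Definition upper_semi_continuous (X : topologicalType) (F : X -> set X) :=
  forall (x : X) (V : set X), open V -> F x `<=` V ->
    exists U : set X, [/\ open U, U x & forall t, U t -> F t `<=` V].

Section Entropy.
Context {R : realType}.

Definition eps_separated (T : Type) (d : T -> T -> R) (eps : R) (S : set T) :=
  forall x y, S x -> S y -> x <> y -> eps <= d x y.

(* The supremum is over the cardinalities of the finite eps-separated subsets of A;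
   it is the largest cardinality when that exists, and +oo when there are
   arbitrarily large (in particular, infinite) eps-separated subsets. *)
Definition max_separated (T : Type) (d : T -> T -> R) (eps : R) (A : set T)
    : \bar R :=
  ereal_sup [set (k%:R)%:E | k in
    [set k : nat | exists S : set T,
      [/\ S `<=` A, (S #= `I_k)%card & eps_separated d eps S]]].

(* The value at n = 0 is irrelevant to the limsup. The outer limit exists
   whenever s n is nonincreasing in eps. *)
Definition growth_rate (s : nat -> R -> \bar R) : \bar R :=
  lim (limn_esup (fun n : nat => (n%:R^-1)%:E * lne (s n eps))%E
       @[eps --> 0^'+]).

Section SetValued.
Context {X : metricType R}.

Definition n_orbits (F : X -> set X) (n : nat) : set (n.-tuple X) :=
  [set x | forall i j : 'I_n, j = i.+1 :> nat -> F (tnth x i) (tnth x j)].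

Definition orbit_dist (n : nat) (x y : n.-tuple X) : R :=
  \big[Num.max/0]_(i < n) mdist (tnth x i) (tnth y i).

Definition set_valued_entropy (F : X -> set X) : \bar R :=
  growth_rate (fun n eps => max_separated (@orbit_dist n) eps (@n_orbits F n)).

End SetValued.

Section SingleValued.
Context {Y : metricType R}.

Definition bowen_dist (f : Y -> Y) (n : nat) (x y : Y) : R :=
  \big[Num.max/0]_(i < n) mdist (iter i f x) (iter i f y).

Definition map_entropy (f : Y -> Y) : \bar R :=
  growth_rate (fun n eps => max_separated (bowen_dist f n) eps setT).

End SingleValued.
End Entropy.

(* The compactness proof cX is a phantom parameter: it is what makes the
   supremum defining the metric rho finite. *)
Record forward_orbit (R : realType) (X : metricType R)
    (cX : compact [set: X]) (F : X -> set X) := ForwardOrbit {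
  orbit_seq :> nat -> X;
  orbit_seqP : forall i, F (orbit_seq i) (orbit_seq i.+1) }.

Section ForwardOrbits.
Context {R : realType} {X : metricType R}.
Variables (cX : compact [set: X]) (F : X -> set X).
Implicit Types x y z : forward_orbit cX F.

Definition rho x y : R :=
  sup [set mdist (x i) (y i) / i.+1%:R | i in [set: nat]].

Definition orbit_shift x : forward_orbit cX F :=
  @ForwardOrbit R X cX F (fun i => x i.+1) (fun i => orbit_seqP x i.+1).

Lemma forward_orbit_inj x y : (forall i, x i = y i) -> x = y.
Proof.
case: x y => [u hu] [v hv] /= /funext uv.
by subst v; congr ForwardOrbit; exact: Prop_irrelevance.
Qed.

Lemma mdist_bounded : exists M : R, forall a b : X, mdist a b <= M.
Proof.
have [[a0 _]|X0] := pselect (exists a : X, True); last first.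
  by exists 0 => a; case: X0; exists a.
have /compact_near_coveringP/(_ nat \oo (fun n a => mdist a0 a <= n%:R) _) := cX.
case.
  move=> a _; exists (ball a 1, [set n | mdist a0 a + 1 <= n%:R]) => /=.
    split; first exact: nbhsx_ballx.
    near=> n; near: n; exact: nbhs_infty_ger.
  move=> [b n] /= []; rewrite ballEmdist/= => ab an.
  by rewrite (le_trans (metric_triangle _ a _))// (le_trans _ an)// lerD2l ltW.
move=> n _ /(_ n (leqnn n)) bn; exists (n%:R + n%:R) => a b.
rewrite (le_trans (metric_triangle _ a0 _))// lerD//; last exact: bn.
by rewrite metric_sym; exact: bn.
Unshelve. all: by end_near. Qed.

Lemma rho_has_sup x y :
  has_sup [set mdist (x i) (y i) / i.+1%:R | i in [set: nat]].
Proof.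
split; first by exists (mdist (x 0) (y 0) / 1%:R); exists 0.
have [M hM] := mdist_bounded; exists M => _ [i _ <-].
by rewrite (le_trans _ (hM (x i) (y i)))// ler_pdivrMr// ler_peMr ?mdist_ge0// ler1n.
Qed.

Lemma le_rho x y i : mdist (x i) (y i) / i.+1%:R <= rho x y.
Proof. by apply: ub_le_sup; [exact: (rho_has_sup x y).2|exists i]. Qed.

Lemma rho_le x y M :
  (forall i, mdist (x i) (y i) / i.+1%:R <= M) -> rho x y <= M.
Proof.
by move=> h; apply: ge_sup => [|_ [i _ <-]//]; exact: (rho_has_sup x y).1.
Qed.

Lemma rhoxx x : rho x x = 0.
Proof.
apply/eqP; rewrite eq_le; apply/andP; split.
  by apply: rho_le => i; rewrite mdistxx mul0r.
by have := le_rho x x 0; rewrite mdistxx mul0r.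
Qed.

Lemma rho_positivity x y : rho x y = 0 -> x = y.
Proof.
move=> r0; apply: forward_orbit_inj => i; apply: mdist_positivity.
apply/eqP; rewrite eq_le mdist_ge0 andbT.
by have := le_rho x y i; rewrite r0 ler_pdivrMr// mul0r.
Qed.

Lemma rho_sym x y : rho x y = rho y x.
Proof.
by rewrite /rho; congr sup; apply: eq_imagel => i _; rewrite metric_sym.
Qed.

Lemma rho_triangle y x z : rho x z <= rho x y + rho y z.
Proof.
apply: rho_le => i; apply: le_trans (lerD (le_rho x y i) (le_rho y z i)).
by rewrite -mulrDl ler_pM2r ?invr_gt0// metric_triangle.
Qed.

HB.instance Definition _ := gen_eqMixin (forward_orbit cX F).
HB.instance Definition _ := gen_choiceMixin (forward_orbit cX F).
HB.instance Definition _ := isMetric.Build R (forward_orbit cX F)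
  rhoxx rho_positivity rho_sym rho_triangle.

Lemma forward_orbit_mdistE x y : mdist x y = rho x y.
Proof. by []. Qed.

End ForwardOrbits.

(* Main.v *)
Require Import Defs.
From mathcomp Require Import all_boot all_order all_algebra.
From mathcomp Require Import all_classical all_reals all_analysis.

(** Fix eps > 0 and compare the separation numbers of F and of the shift at
    that same scale.

    Every n-orbit of F extends to a forward orbit because the values of F are
    nonempty, and the coordinate 0 of the i-th shift of a forward orbit is its
    coordinate i, so the Bowen distance of two extensions dominates the
    distance of the n-orbits ([max_separated_orbits_le_shift]).

    Conversely the metric rho damps the coordinate j by 1/(j+1): since X is
    bounded, say by M, the coordinates of index greater than k contribute
    less than eps as soon as M < eps (k+1).  Hence two forward orbits that are
    eps-apart for the n-th Bowen distance already have eps-apart prefixes of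
    length n + k ([max_separated_shift_le_orbits]).

    Altogether s_n(F) <= s_n(shift) <= s_(n+k)(F) with k depending on eps
    only.  Passing from n to n + k multiplies (1/n) log s_n by a factor
    tending to 1 ([limn_esup_shift_index]), so both exponential growth rates
    agree for each eps > 0, and hence so do their limits at 0. *)

Set Implicit Arguments.
Unset Strict Implicit.
Unset Printing Implicit Defensive.

Import Order.TTheory GRing.Theory Num.Theory.

Local Open Scope classical_set_scope.
Local Open Scope ring_scope.

Lemma limn_esup_le_near {R : realType} (u : nat -> \bar R) (c : \bar R) :
  (\forall n \near \oo, (u n <= c)%E) -> (limn_esup u <= c)%E.
Proof.
move=> uc; rewrite /limn_esup limf_esupE.
apply: (@le_trans _ _ (ereal_sup [set u n | n in [set n | (u n <= c)%E]])).
  by apply: ereal_inf_lbound; exists [set n | (u n <= c)%E].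
by apply: ge_ereal_sup => _ [n ? <-].
Qed.

Lemma le_limn_esup {R : realType} (u v : nat -> \bar R) :
  (forall n, (u n <= v n)%E) -> (limn_esup u <= limn_esup v)%E.
Proof.
move=> uv; rewrite {2}/limn_esup limf_esupE.
apply: le_ereal_inf_tmp => _ [V Vn <-].
apply: limn_esup_le_near; apply: filterS Vn => n Vn.
by apply: le_trans (uv n) _; apply: ereal_sup_ubound; exists n.
Qed.

(** The quotient (n + k) / n tends to 1, so for each r < 1 the term of index n
    on the left, times r, is eventually below the term of index n + k on the
    right.  The sign of b is essential: this is where r / n <= 1 / (n + k) gets
    multiplied by b. *)
Lemma limn_esup_shift_index {R : realType} (b : nat -> \bar R) (k : nat) :
  (forall n, (0 <= b n)%E) ->
  (limn_esup (fun n => (n%:R^-1)%:E * b (n + k)%N) <=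
   limn_esup (fun n => (n%:R^-1)%:E * b n))%E.
Proof.
move=> b0; rewrite {2}/limn_esup limf_esupE.
apply: le_ereal_inf_tmp => _ [V [N _ NV] <-].
set c := ereal_sup _.
apply/lee_mul01Pr.
  apply: limf_esup_ge0 => [|n]; first exact: filter_not_empty.
  by rewrite mule_ge0// lee_fin invr_ge0.
move=> r /andP[r0 r1].
rewrite -[r]invrK lee_pdivrMl ?invr_gt0//.
apply: limn_esup_le_near; near=> n.
rewrite -lee_pdivrMl ?invr_gt0// invrK muleA -EFinM.
apply: (@le_trans _ _ (((n + k)%:R^-1)%:E * b (n + k)%N)%E); last first.
  apply: ereal_sup_ubound; exists (n + k)%N => //.
  by apply: NV => /=; rewrite (leq_trans _ (leq_addr _ _))//; near: n; exists N.
have n0 : (0 < n)%N by near: n; exists 1%N.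
apply: lee_wpmul2r => //.
rewrite lee_fin ler_pdivrMr ?ltr0n// mulrC ler_pdivlMr ?ltr0n ?addn_gt0 ?n0//.
rewrite natrD mulrDr -lerBrDl.
have -> : n%:R - r * n%:R = (1 - r) * n%:R by rewrite mulrBl mul1r.
rewrite -ler_pdivrMl ?subr_gt0//.
by near: n; exact: nbhs_infty_ger.
Unshelve. all: by end_near. Qed.

(** A map that keeps eps-distant points eps-distant is injective on
    eps-separated sets, because d' vanishes on the diagonal and eps > 0. *)
Lemma le_max_separated {R : realType} (T T' : Type) (d : T -> T -> R)
    (d' : T' -> T' -> R) (eps : R) (A : set T) (B : set T') (f : T -> T') :
  0 < eps -> (forall z, d' z z = 0) -> (forall x, A x -> B (f x)) ->
  (forall x y, A x -> A y -> eps <= d x y -> eps <= d' (f x) (f y)) ->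
  (max_separated d eps A <= max_separated d' eps B)%E.
Proof.
move=> eps0 d'0 AB fd; apply: ereal_sup_le => _ [k [S [SA Sk sepS]] <-].
have sepf x y : S x -> S y -> x <> y -> eps <= d' (f x) (f y).
  by move=> Sx Sy xy; apply: fd; [exact: SA|exact: SA|exact: sepS].
exists k => //; exists (f @` S); split.
- by move=> _ [x /SA Ax <-]; exact: AB.
- apply: card_eq_trans Sk; apply: inj_card_eq => x y /set_mem Sx /set_mem Sy.
  move=> fxy; apply: contrapT => xy.
  by have := sepf _ _ Sx Sy xy; rewrite fxy d'0 leNgt eps0.
- move=> _ _ [x Sx <-] [y Sy <-] fxy.
  by apply: sepf => // xy; apply: fxy; rewrite xy.
Qed.

Lemma max_separated_ge0 {R : realType} (T : Type) (d : T -> T -> R) (eps : R)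
    (A : set T) :
  (0 <= max_separated d eps A)%E.
Proof.
apply: ereal_sup_ubound; exists 0%N => //; exists set0; split => //.
by rewrite II0.
Qed.

Lemma max_separated_ge1 {R : realType} (T : Type) (d : T -> T -> R) (eps : R)
    (A : set T) :
  A !=set0 -> (1 <= max_separated d eps A)%E.
Proof.
move=> [a Aa]; apply: ereal_sup_ubound; exists 1%N => //.
exists [set a]; split => [x -> //||x y -> -> //].
exact: card_set1.
Qed.

Section OrbitComparison.
Context {R : realType} {X : metricType R}.
Variables (cX : compact [set: X]) (F : X -> set X).
Implicit Types x y : forward_orbit cX F.

Local Notation shift := (@orbit_shift R X cX F).

Lemma iter_orbit_shiftE n x i : iter n shift x i = x (n + i)%N.
Proof. by elim: n i => [//|n IH] i; rewrite iterS /= IH addnS. Qed.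

Definition orbit_prefix n x : n.-tuple X := [tuple x i | i < n].

Lemma orbit_prefix_orbit n x : n_orbits F (orbit_prefix n x).
Proof. by move=> i j ji; rewrite !tnth_mktuple ji; exact: orbit_seqP. Qed.

Lemma orbit_distxx n (u : n.-tuple X) : orbit_dist u u = 0.
Proof. by apply: big1_idem => [|i _]; [exact: maxxx|exact: mdistxx]. Qed.

Lemma bowen_distxx (Y : metricType R) (f : Y -> Y) n (y : Y) :
  bowen_dist f n y y = 0.
Proof. by apply: big1_idem => [|i _]; [exact: maxxx|exact: mdistxx]. Qed.

(** The quotient by [j + 1] is what makes rho insensitive to far coordinates:
    those of index greater than [k] contribute at most [M / (k + 1)]. *)
Lemma rho_le_prefix (M delta : R) k x y :
  (forall a b : X, mdist a b <= M) ->
  (forall j, (j <= k)%N -> mdist (x j) (y j) <= delta) ->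
  rho x y <= Num.max delta (M / k.+1%:R).
Proof.
move=> hM hdelta; apply: rho_le => j; rewrite le_max.
have [jk|kj] := leqP j k; apply/orP; [left|right].
  apply: le_trans (hdelta _ jk).
  by rewrite ler_pdivrMr// ler_peMr ?mdist_ge0// ler1n.
apply: (@le_trans _ _ (M / j.+1%:R)); first by rewrite ler_pM2r ?invr_gt0.
rewrite ler_wpM2l ?(le_trans (mdist_ge0 (x 0) (y 0)))//.
by rewrite lef_pV2 ?posrE// ler_nat ltnS ltnW.
Qed.

Lemma bowen_dist_shift_le (M : R) n k x y :
  (forall a b : X, mdist a b <= M) ->
  bowen_dist shift n x y <=
    Num.max (orbit_dist (orbit_prefix (n + k) x) (orbit_prefix (n + k) y))
            (M / k.+1%:R).
Proof.
move=> hM; have M0 : 0 <= M by rewrite (le_trans (mdist_ge0 (x 0) (x 0))).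
apply: bigmax_le => [|i _]; first by rewrite le_max divr_ge0 ?orbT.
rewrite forward_orbit_mdistE; apply: rho_le_prefix => // j jk.
have ijnk : (i + j < n + k)%N by rewrite -addSn leq_add.
rewrite !iter_orbit_shiftE.
have := le_bigmax 0 (fun l : 'I_(n + k) => mdist
  (tnth (orbit_prefix (n + k) x) l) (tnth (orbit_prefix (n + k) y) l))
  (Ordinal ijnk).
by rewrite !tnth_mktuple.
Qed.

Lemma max_separated_shift_le_orbits (M eps : R) n k :
  0 < eps -> (forall a b : X, mdist a b <= M) -> M < eps * k.+1%:R ->
  (max_separated (bowen_dist shift n) eps setT <=
   max_separated (@orbit_dist R X (n + k)) eps (@n_orbits R X F (n + k)))%E.
Proof.
move=> eps0 hM Meps; apply: (le_max_separated (f := orbit_prefix (n + k))) => //.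
- exact: orbit_distxx.
- by move=> x _; exact: orbit_prefix_orbit.
- move=> x y _ _ /le_trans/(_ (bowen_dist_shift_le n k x y hM)).
  by rewrite le_max => /orP[//|]; rewrite leNgt ltr_pdivrMr// Meps.
Qed.

Hypothesis F0 : forall a : X, F a !=set0.

(** An orbit is provided even when [u] is not an n-orbit, so that choosing
    extensions gives a total function. *)
Lemma orbit_extension n (u : n.+1.-tuple X) :
  exists x, n_orbits F u -> forall i : 'I_n.+1, x i = tnth u i.
Proof.
have [f fF] := choice F0.
have [uF|nuF] := pselect (n_orbits F u); last first.
  by exists (@ForwardOrbit R X cX F (fun i => iter i f (tnth u ord0))
    (fun i => fF _)).
(* Follow u up to its last entry, then iterate f; truncated subtraction
   makes the number of iterations 0 along u. *)
pose z i := iter (i - n) f (tnth u (inord (minn i n))).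
have zF i : F (z i) (z i.+1).
  rewrite /z; have [ni|lt_in] := leqP n i.
    by rewrite subSn//= (minn_idPr (leqW ni)); exact: fF.
  have -> : (i - n = 0)%N by apply/eqP; rewrite subn_eq0 ltnW.
  have -> : (i.+1 - n = 0)%N by apply/eqP; rewrite subn_eq0.
  rewrite /= (minn_idPl lt_in).
  by apply: uF; rewrite !inordK// ltnS ltnW.
exists (ForwardOrbit cX zF) => _ i /=.
have le_in : (i <= n)%N by rewrite -ltnS.
have -> : z i = tnth u (inord (minn i n)).
  by rewrite /z; move: le_in; rewrite -subn_eq0 => /eqP ->.
by rewrite (minn_idPl le_in) inord_val.
Qed.

Lemma max_separated_orbits_le_shift (eps : R) n : 0 < eps ->
  (max_separated (@orbit_dist R X n.+1) eps (@n_orbits R X F n.+1) <=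
   max_separated (bowen_dist shift n.+1) eps setT)%E.
Proof.
move=> eps0; have [e eP] := choice (@orbit_extension n).
apply: (le_max_separated (f := e)) => //; first exact: bowen_distxx.
move=> u v uF vF /le_trans; apply.
apply: bigmax_le => [|i _]; first exact: bigmax_ge_id.
apply: le_trans (le_bigmax 0 (fun j : 'I_n.+1 => mdist
  (iter j shift (e u)) (iter j shift (e v))) i).
rewrite forward_orbit_mdistE.
have := le_rho (iter i shift (e u)) (iter i shift (e v)) 0.
by rewrite !iter_orbit_shiftE !addn0 divr1 (eP u uF) (eP v vF).
Qed.

(** The two systems grow equally fast at each scale, not only in the limit: the
    delay k depends on eps but not on n, and delays are invisible to the
    exponential growth rate. *)
Lemma limn_esup_shift_eq_orbits (eps : R) : 0 < eps ->
  limn_esup (fun n => (n%:R^-1)%:E *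
    lne (max_separated (bowen_dist shift n) eps setT))%E =
  limn_esup (fun n => (n%:R^-1)%:E *
    lne (max_separated (@orbit_dist R X n) eps (@n_orbits R X F n)))%E.
Proof.
move=> eps0; set t := fun n =>
  max_separated (@orbit_dist R X n) eps (@n_orbits R X F n).
have ln_mono (T T' : Type) d d' (A : set T) (A' : set T') n :
    (max_separated d eps A <= max_separated d' eps A')%E ->
    ((n%:R^-1)%:E * lne (max_separated d eps A) <=
     (n%:R^-1)%:E * lne (max_separated d' eps A'))%E.
  move=> le; apply: lee_wpmul2l; first by rewrite lee_fin invr_ge0.
  by rewrite lee_lne// in_itv/= ?leey ?max_separated_ge0.
apply/eqP; rewrite eq_le; apply/andP; split; last first.
  apply: le_limn_esup => -[|n]; first by rewrite invr0 !mul0e.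
  by apply: ln_mono; exact: max_separated_orbits_le_shift.
have [[a _]|X0] := pselect (exists a : X, True); last first.
  (* For n > 0 the logarithms are then -oo, out of reach of
     limn_esup_shift_index; but M = 0 bounds the distances, so k = 0 will do. *)
  have hM (b c : X) : mdist b c <= 0 by case: X0; exists b.
  apply: le_limn_esup => n; apply: ln_mono.
  have := @max_separated_shift_le_orbits 0 eps n 0 eps0 hM.
  by rewrite addn0; apply; rewrite mulr1.
have [M hM] := mdist_bounded cX.
pose k := Num.truncn (M / eps).
have Meps : M < eps * k.+1%:R.
  by rewrite -ltr_pdivrMl// mulrC truncnS_gt.
apply: (@le_trans _ _ (limn_esup (fun n => (n%:R^-1)%:E * lne (t (n + k)%N))))%E.
  apply: le_limn_esup => n; apply: ln_mono.
  exact: max_separated_shift_le_orbits hM Meps.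
apply: (limn_esup_shift_index (b := fun n => lne (t n))) => n.
rewrite lne_ge0; apply: max_separated_ge1.
case: n => [|n]; first by exists [tuple] => -[].
have [x _] := orbit_extension [tuple a | i < n.+1].
by exists (orbit_prefix n.+1 x); exact: orbit_prefix_orbit.
Qed.

End OrbitComparison.

Theorem theorem3p1 (R : realType) (X : metricType R) (cX : compact [set: X])
    (F : X -> set X) (hF : forall x : X, hyperspace (F x))
    (uF : upper_semi_continuous F) :
  map_entropy (@orbit_shift R X cX F) = set_valued_entropy F.
Proof.
have F0 a : F a !=set0 by have [] := hF a.
rewrite /map_entropy /set_valued_entropy /growth_rate.
congr (lim _); apply/seteqP; split; apply: near_eq_cvg; near=> eps.
- by apply: limn_esup_shift_eq_orbits => //; near: eps; exact: nbhs_right_gt.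
- by apply/esym/limn_esup_shift_eq_orbits => //; near: eps; exact: nbhs_right_gt.
Unshelve. all: by end_near. Qed.
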